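(* Let $T$ be a tournament whose directed domination graph $\vec{D}(T)$ contains a directed cycle $C$ with $V(C)=V(T)$. Then $T$ has a unique minimal $\tau$-retentive set.
   Context: A tournament $T$ consists of a finite vertex set $V(T)$ and an asymmetric, complete binary relation $\succ$ on $V(T)$ ($x$ dominates $y$ if $x\succ y$). For $v\in V(T)$ let $N^-_T(v)=\{u: u\succ v\}$; for $B\subseteq V(T)$, $T[B]$ is the induced subtournament. A vertex $u$ is the captain of a vertex $v$ in $T$ if $u\succ v$ and $u\succ w$ for every $w\in N^-_T(v)\setminus\{u\}$. The directed domination graph $\vec{D}(T)$ has vertex set $V(T)$ and an arc from $u$ to $v$ iff $u$ is the captain of $v$ in $T$. A directed cycle is a sequence of distinct vertices $(v_0,\dots,v_{k-1})$ with an arc from $v_i$ to $v_{(i+1)\bmod k}$ for all $i$; $V(C)$ is its vertex set. The tournament equilibrium set $\tau$ is defined recursively: a nonempty $A\subseteq V(T)$ is $\tau$-retentive if for every $v\in A$ with $N^-_T(v)\neq\emptyset$, $\tau(T[N^-_T(v)])\subseteq A$; $A$ is a minimal $\tau$-retentive set if no $\tau$-retentive set of $T$ is a proper subset of $A$; $\tau(T)$ is the union of all minimal $\tau$-retentive sets of $T$. *)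

(* Defs.v *)
From mathcomp Require Import all_boot.

Set Implicit Arguments.
Unset Strict Implicit.
Unset Printing Implicit Defensive.

Record tournament := Tournament {
  vertex :> finType;
  dom : rel vertex;
  dom_asym : forall x y, dom x y -> ~~ dom y x;
  dom_complete : forall x y, x != y -> dom x y || dom y x
}.

(* The subtournament T[B] is represented by its vertex set B : {set T}, with
   the relation dom of T; T itself is T[setT]. inN B v is the in-neighbourhood
   of v in T[B]. *)
Definition inN (T : tournament) (B : {set T}) (v : T) : {set T} :=
  [set u in B | dom u v].

Definition captain (T : tournament) (u v : T) : bool :=
  dom u v && [forall w in inN setT v :\ u, dom u w].

(* The vertices of T with rel captain form the directed domination graph. For
   a nonempty duplicate-free c, cycle e c says that e holds from each item to
   the next one, cyclically; cycle e [::] is true, hence the first conjunct. *)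
Definition domination_cycle (T : tournament) (c : seq T) : bool :=
  (c != [::]) && ucycleb (@captain T) c.

Section Tau.
Variable T : tournament.
Implicit Types (s : {set T} -> {set T}) (A B : {set T}).

(* A is s-retentive in T[B]; s assigns to the vertex set of each subtournament
   the subset it selects. *)
Definition retentive s B A : bool :=
  [&& A \subset B, A != set0
    & [forall v in A, (inN B v != set0) ==> (s (inN B v) \subset A)]].

Definition minimal_retentive s B A : bool := minset (retentive s B) A.

(* The tournament equilibrium set, by recursion on a bound n for #|B|: the
   in-neighbourhood of a vertex of T[B] has fewer vertices than B. *)
Fixpoint tau_rec n B : {set T} :=
  if n is n'.+1 then
    \bigcup_(A : {set T} | minimal_retentive (tau_rec n') B A) A
  else set0.

Definition tau B : {set T} := tau_rec #|B| B.

Lemma inN_card B v : v \in B -> #|inN B v| < #|B|.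
Proof.
move=> vB; apply: proper_card; apply/properP; split.
  by apply/subsetP => u; rewrite inE => /andP[].
exists v => //; rewrite inE vB /=; apply/negP => vv.
by move: (dom_asym vv); rewrite vv.
Qed.

Lemma eq_minimal_retentive s1 s2 B :
    (forall B', #|B'| < #|B| -> s1 B' = s2 B') ->
  minimal_retentive s1 B =1 minimal_retentive s2 B.
Proof.
move=> eqs A; apply: minset_eq => {}A; rewrite /retentive.
have [/subsetP sAB|] //= := boolP (A \subset B).
congr andb; apply: eq_forallb => v.
by have [vA|] //= := boolP (v \in A); rewrite eqs // inN_card // sAB.
Qed.

Lemma eq_tau_rec m n B : #|B| <= m -> #|B| <= n -> tau_rec m B = tau_rec n B.
Proof.
have rec0 k B' : #|B'| <= 0 -> tau_rec k B' = set0.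
  rewrite leqn0 cards_eq0 => /eqP ->; case: k => //= k.
  apply: big1 => A /minsetp; rewrite /retentive subset0.
  by case/and3P => /eqP ->; rewrite eqxx.
elim: m n B => [|m IH] [|n] B lem len; try by rewrite !rec0.
apply: eq_bigl => A; apply: eq_minimal_retentive => B' ltB'.
by apply: IH; rewrite -ltnS; apply: leq_trans ltB' _.
Qed.

(* The defining equation of the tournament equilibrium set. *)
Lemma tauE B : tau B = \bigcup_(A : {set T} | minimal_retentive tau B A) A.
Proof.
rewrite /tau (@eq_tau_rec _ #|B|.+1) //=; apply: eq_bigl => A.
apply: eq_minimal_retentive => B' /ltnW leB'; exact: eq_tau_rec.
Qed.

End Tau.

(* Main.v *)
Require Import Defs.
From mathcomp Require Import all_boot.

(* The captain of v dominates every other in-neighbour of v, so tau selects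
   exactly the captain from the in-neighbourhood of v. A tau-retentive set thus
   contains the captain of each of its vertices, and walking backwards along
   the spanning cycle shows that it contains every vertex: the whole vertex set
   is the only tau-retentive set. *)

(** By induction on the size of [B], [u] lies in every retentive set [A]: if [v] in [A] differs from
    [u], then [u] dominates the rest of [inN B v], so [tau] of that smaller set is [[set u]], which
    retentiveness puts inside [A]. As [[set u]] is itself retentive, it is the only minimal
    retentive set. *)
Lemma tau_winner (T : tournament) (B : {set T}) (u : T) :
  u \in B -> {in B :\ u, forall w, dom u w} -> tau B = [set u].
Proof.
have [n] := ubnP #|B|; elim: n B => // n IH B ltBn uB domu.
have ret_u A : retentive (@tau T) B A -> u \in A.
  case/and3P=> /subsetP sAB /set0Pn[v vA] /forall_inP retA.
  have [<- //|neq_vu] := eqVneq v u.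
  have uNv : u \in inN B v by rewrite inE uB domu // !inE neq_vu sAB.
  have tauNv : tau (inN B v) = [set u].
    apply: IH => // [|w]; first by apply: leq_trans (inN_card (sAB v vA)) ltBn.
    by rewrite !inE => /and3P[neq_wu wB _]; rewrite domu // !inE neq_wu.
  have /implyP := retA v vA; rewrite tauNv sub1set; apply.
  by apply/set0Pn; exists u.
have ret1 : retentive (@tau T) B [set u].
  apply/and3P; split; first by rewrite sub1set.
    by apply/set0Pn; exists u; rewrite set11.
  (* The condition at [u] is vacuous: asymmetry excludes an in-neighbour [w] of [u] in [B],
     including [w = u]. *)
  apply/forall_inP => v /set1P->; apply/implyP => /set0Pn[w].
  rewrite inE => /andP[wB domwu]; have := dom_asym domwu.
  have [eq_wu|neq_wu] := eqVneq w u; last by rewrite domu // !inE neq_wu.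
  by move: domwu; rewrite eq_wu => ->.
rewrite tauE (big_pred1 [set u]) // => A.
apply/idP/eqP => [/minsetP[retA minA]|->].
  by rewrite (minA [set u]) // sub1set ret_u.
apply/minsetP; split=> // A' retA' sA'u; apply/eqP.
by rewrite eqEsubset sA'u sub1set ret_u.
Qed.

Lemma captain_tau (T : tournament) (u v : T) :
  captain u v -> tau (inN [set: T] v) = [set u].
Proof.
case/andP=> domuv /forall_inP capt; apply: tau_winner => //.
by rewrite !inE.
Qed.

Lemma retentive_captain (T : tournament) (A : {set T}) (u v : T) :
  retentive (@tau T) [set: T] A -> captain u v -> v \in A -> u \in A.
Proof.
case/and3P=> _ _ /forall_inP retA capt vA.
have /implyP := retA v vA; rewrite (captain_tau _ _ _ capt) sub1set; apply.
by apply/set0Pn; exists u; case/andP: capt => domuv _; rewrite !inE.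
Qed.

(** The hypothesis sits at the end of the path because membership in a retentive set passes from a
    vertex to its captain, against the arcs. *)
Lemma path_all_last (T : Type) (e : rel T) (P : pred T) (x : T) (s : seq T) :
  (forall y z, e y z -> P z -> P y) -> path e x s -> P (last x s) ->
  all P (x :: s).
Proof.
move=> clP; elim: s x => [|y s IHs] x /=; first by move=> _ ->.
case/andP=> e_xy /IHs{}IHs /IHs /= /andP[Py ->].
by rewrite (clP x y) ?Py.
Qed.

(** Rotated to start at [x], the cycle is a path from [x] back to [x], so the endpoint where
    [path_all_last] needs [P] is [x] itself. *)
Lemma cycle_all_has (T : eqType) (e : rel T) (P : pred T) (c : seq T) :
  (forall y z, e y z -> P z -> P y) -> cycle e c -> has P c -> all P c.
Proof.
move=> clP cyc_c /hasP[x /rot_to[i s def_s] Px].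
rewrite -(eq_all_r (mem_rot i c)) def_s; move: cyc_c; rewrite -(rot_cycle i e) def_s /=.
move/(path_all_last _ _ _ _ _ clP); rewrite last_rcons /= all_rcons.
by move=> /(_ Px) /and3P[-> _ ->].
Qed.

Theorem theorem9 (T : tournament) (c : seq T) :
  domination_cycle c -> [set v in c] = [set: T] ->
  exists! A : {set T}, minimal_retentive (@tau T) [set: T] A.
Proof.
case/andP=> c_neq0 /andP[cyc_c _] span_c.
have mem_c x : x \in c by have := in_setT x; rewrite -span_c inE.
have retT A : retentive (@tau T) [set: T] A -> A = [set: T].
  move=> retA; have /and3P[_ /set0Pn[v vA] _] := retA.
  apply/eqP; rewrite -subTset; apply/subsetP => x _.
  have clA y z := retentive_captain T A y z retA.
  apply: (allP (cycle_all_has _ _ (mem A) _ clA cyc_c _)) (mem_c x).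
  by apply/hasP; exists v.
have T_ret : retentive (@tau T) [set: T] [set: T].
  apply/and3P; split=> //; last by apply/forall_inP => v _; rewrite subsetT implybT.
  (* The head of the nonempty cycle witnesses that [T] has a vertex. *)
  by case: c c_neq0 {cyc_c span_c mem_c} => // v s _; apply/set0Pn; exists v.
(* [retT] gives both uniqueness and minimality. *)
exists [set: T]; split=> [|A /minsetp/retT //].
by apply/minsetP; split=> // A /retT.
Qed.
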